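(* Let $n\ge 1$ and $0<\delta<n$. Then there exists a Lebesgue measurable function in $\mathrm{N}L^1(\mathbb{R}^n,\tilde{\mathcal H}^\delta_\infty)$ which is not an $\mathrm{N}L^1$-limit of continuous functions. In particular, continuous functions are not dense in $\mathrm{N}L^1(\mathbb{R}^n,\tilde{\mathcal H}^\delta_\infty)$ with respect to the norm $\|f\|_1=\int_{\mathbb{R}^n}|f|\,d\tilde{\mathcal H}^\delta_\infty$.
   Context: Dyadic cubes: for $k\in\mathbb{Z}$ let $\mathcal Q_k$ be the collection of half-open cubes $Q$ with vertices in the lattice $(2^k\mathbb{Z})^n$, each a translate of $[0,2^k)^n$; its side length is $\ell(Q)=2^k$. Dyadic cubes are the elements of $\bigcup_{k\in\mathbb{Z}}\mathcal Q_k$. Dyadic Hausdorff content: for $\delta\in(0,n]$ and any $E\subset\mathbb{R}^n$, $\tilde{\mathcal H}^\delta_\infty(E):=\inf\{\sum_{i}\ell(Q_i)^\delta : E\subset \operatorname{int}(\bigcup_{i}Q_i)\}$, the infimum being over all countable (or finite) collections of dyadic cubes $Q_i$. Choquet integral: for any set $\Omega\subset\mathbb{R}^n$ and any function $f:\Omega\to[0,\infty]$ (no measurability required), $\int_\Omega f\,d\tilde{\mathcal H}^\delta_\infty:=\int_0^\infty\tilde{\mathcal H}^\delta_\infty(\{x\in\Omega: f(x)>t\})\,dt$. $\mathrm{N}L^1(\Omega,\tilde{\mathcal H}^\delta_\infty)$ is the set of all (possibly non-measurable) functions $f:\Omega\to[-\infty,\infty]$ with $\int_\Omega|f|\,d\tilde{\mathcal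 H}^\delta_\infty<\infty$, functions coinciding outside a set of zero $\tilde{\mathcal H}^\delta_\infty$-content being identified. A function $f\in\mathrm{N}L^1(\mathbb{R}^n,\tilde{\mathcal H}^\delta_\infty)$ is an $\mathrm{N}L^1$-limit of continuous functions if there is a sequence of continuous functions $\phi_i:\mathbb{R}^n\to\mathbb{R}$ such that $\int_{\mathbb{R}^n}|f-\phi_i|\,d\tilde{\mathcal H}^\delta_\infty\to 0$ as $i\to\infty$. *)

(* Defs.v *)
From HB Require Import structures.
From mathcomp Require Import all_boot all_order all_algebra.
From mathcomp Require Import all_classical all_reals all_analysis.
From mathcomp Require Import measurable_realfun.

Set Implicit Arguments.
Unset Strict Implicit.
Unset Printing Implicit Defensive.

Import Order.TTheory GRing.Theory Num.Theory.
Import numFieldNormedType.Exports.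

Local Open Scope classical_set_scope.
Local Open Scope ring_scope.

(* R^n is 'rV[R]_n with its product topology.  A countable or finite family
   is a function on nat restricted to an arbitrary index set D : set nat. *)

Section dyadic.
Context {R : realType} {n : nat}.

(* The pair (k, m) encodes the dyadic cube 2^k m + [0, 2^k)^n. *)
Definition dyadic : Type := (int * 'rV[int]_n)%type.

Definition side (Q : dyadic) : R := 2%:R ^ Q.1.

Definition cube (Q : dyadic) : set 'rV[R]_n :=
  [set x | forall i : 'I_n,
     (Q.2 ord0 i)%:~R * side Q <= x ord0 i < (Q.2 ord0 i + 1)%:~R * side Q].

Definition dyadic_content (delta : R) (E : set 'rV[R]_n) : \bar R :=
  ereal_inf [set s | exists D : set nat, exists Q : nat -> dyadic,
    E `<=` interior (\bigcup_(i in D) cube (Q i)) /\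
    s = (\esum_(i in D) (side (Q i) `^ delta)%:E)%E].

(* The value of f outside Omega is irrelevant. *)
Definition choquet (delta : R) (Omega : set 'rV[R]_n) (f : 'rV[R]_n -> \bar R)
    : \bar R :=
  (\int[@lebesgue_measure R]_(t in `]0%R, +oo[)
     dyadic_content delta [set x | Omega x /\ t%:E < f x])%E.

Definition NL1_norm (delta : R) (Omega : set 'rV[R]_n)
    (f : 'rV[R]_n -> \bar R) : \bar R :=
  choquet delta Omega (fun x => `|f x|%E).

(* Elements of N L^1 are given by representatives: the norm of a difference
   only depends on the functions up to sets of zero content. *)
Definition NL1 (delta : R) (Omega : set 'rV[R]_n)
    : set ('rV[R]_n -> \bar R) :=
  [set f | (NL1_norm delta Omega f < +oo)%E].

Definition NL1_limit_continuous (delta : R) (f : 'rV[R]_n -> \bar R) : Prop :=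
  exists phi : nat -> 'rV[R]_n -> R,
    (forall i, continuous (phi i)) /\
    (fun i => NL1_norm delta setT (fun x => f x - (phi i x)%:E)%E)
      @ \oo --> 0%E.

Definition continuous_dense_NL1 (delta : R) : Prop :=
  forall f, NL1 delta setT f -> forall e : R, 0 < e ->
    exists phi : 'rV[R]_n -> R,
      [/\ continuous phi,
          NL1 delta setT (fun x => (phi x)%:E) &
          (NL1_norm delta setT (fun x => f x - (phi x)%:E) < e%:E)%E].

End dyadic.

Arguments dyadic : clear implicits.

Section lebesgue.
Context {R : realType} {n : nat}.

(* The pair (a, b) encodes the half-open box \prod_i [a_i, b_i). *)
Definition box (ab : 'rV[R]_n * 'rV[R]_n) : set 'rV[R]_n :=
  [set x | forall i : 'I_n, ab.1 ord0 i <= x ord0 i < ab.2 ord0 i].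

Definition box_volume (ab : 'rV[R]_n * 'rV[R]_n) : R :=
  \prod_(i < n) Num.max 0 (ab.2 ord0 i - ab.1 ord0 i).

Definition lebesgue_outer (E : set 'rV[R]_n) : \bar R :=
  ereal_inf [set s | exists D : set nat, exists B : nat -> 'rV[R]_n * 'rV[R]_n,
    E `<=` \bigcup_(i in D) box (B i) /\
    s = (\esum_(i in D) (box_volume (B i))%:E)%E].

Local Open Scope ereal_scope.

Lemma box_volume_ge0 ab : (0 <= box_volume ab)%R.
Proof. by apply: prodr_ge0 => i _; rewrite le_max lexx. Qed.

Lemma lebesgue_outer_ge0 E : 0 <= lebesgue_outer E.
Proof.
apply: le_ereal_inf_tmp => _ [D [B [_ ->]]].
by apply: esum_ge0 => i _; rewrite lee_fin box_volume_ge0.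
Qed.

Lemma lebesgue_outer0 : lebesgue_outer set0 = 0.
Proof.
apply/eqP; rewrite eq_le lebesgue_outer_ge0 andbT.
apply: ereal_inf_lbound; exists set0, (fun=> (0%R, 0%R)); split => //.
by rewrite esum_set0.
Qed.

Lemma le_lebesgue_outer :
  {homo lebesgue_outer : A B / A `<=` B >-> A <= B}.
Proof.
move=> E F EF; apply: ereal_inf_le_tmp => _ [D [B [FB ->]]].
by exists D, B; split => //; exact: subset_trans FB.
Qed.

Lemma lebesgue_outer_sigma_subadditive : sigma_subadditive lebesgue_outer.
Proof.
move=> F; have [->|] := eqVneq (\sum_(i <oo) lebesgue_outer (F i)) +oo.
  by rewrite leey.
move=> sumfin; apply/lee_addgt0Pr => e e0.
have Fin k : lebesgue_outer (F k) \is a fin_num.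
  rewrite ge0_fin_numE ?lebesgue_outer_ge0// ltey.
  apply: contra sumfin => /eqP Fk; apply/eqP; apply: (eseries_pinfty _ _ Fk) => //.
  by move=> i _; rewrite -ltNye (lt_le_trans _ (lebesgue_outer_ge0 _)).
have /choice[DB DBP] k : exists DB : set nat * (nat -> 'rV[R]_n * 'rV[R]_n),
    F k `<=` \bigcup_(i in DB.1) box (DB.2 i) /\
    \esum_(i in DB.1) (box_volume (DB.2 i))%:E <=
      lebesgue_outer (F k) + (e / (2 ^ k.+1)%:R)%:E.
  have ek0 : (0 < e / (2 ^ k.+1)%:R)%R.
    by rewrite divr_gt0// ltr0n expn_gt0.
  have [_ [D [B [FB ->]]] lt] := lb_ereal_inf_adherent ek0 (Fin k).
  by exists (D, B); split => //; exact: ltW.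
pose J := setT `*`` (fun k => (DB k).1).
pose Q m := let p := odflt (0, 0)%N (unpickle m) in (DB p.1).2 p.2.
apply: (@le_trans _ _ (\esum_(m in pickle @` J) (box_volume (Q m))%:E)).
  apply: ereal_inf_lbound; exists (pickle @` J), Q; split => //.
  move=> x [k _ /(DBP k).1[i Di xi]].
  by exists (pickle (k, i)); [exists (k, i)|rewrite /Q pickleK].
rewrite esum_image; last by move=> x y _ _; exact: (pcan_inj pickleK).
under eq_esum do rewrite /Q pickleK/=.
rewrite -(@esum_esum _ _ _ setT _ (fun k i => (box_volume ((DB k).2 i))%:E));
  last by move=> k i _ _; rewrite lee_fin box_volume_ge0.
rewrite -nneseries_esumT; last first.
  by move=> k; apply: esum_ge0 => i _; rewrite lee_fin box_volume_ge0.
rewrite (le_trans _ (epsilon_trick xpredT _ (ltW e0)))//; last first.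
  by move=> k; exact: lebesgue_outer_ge0.
apply: lee_nneseries => [k _ _|k _]; last exact: (DBP k).2.
by apply: esum_ge0 => i _; rewrite lee_fin box_volume_ge0.
Qed.

HB.instance Definition _ := isOuterMeasure.Build R 'rV[R]_n lebesgue_outer
  lebesgue_outer0 lebesgue_outer_ge0 le_lebesgue_outer
  lebesgue_outer_sigma_subadditive.

End lebesgue.

(* Measurability with respect to the sigma-algebra of Lebesgue measurable sets,
   i.e. the Caratheodory measurable sets of the Lebesgue outer measure. *)
Definition lebesgue_measurable_fun (R : realType) (n : nat)
    (f : 'rV[R]_n -> \bar R) : Prop :=
  measurable_fun setT (f : caratheodory_type (@lebesgue_outer R n) -> \bar R).

(* Main.v *)
Require Import Defs.
From mathcomp Require Import all_boot all_order all_algebra.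
From mathcomp Require Import all_classical all_reals all_analysis.
From mathcomp Require Import measurable_realfun zify ring lra.
Set Implicit Arguments.
Unset Strict Implicit.
Unset Printing Implicit Defensive.
Import Order.TTheory GRing.Theory Num.Theory.
Import numFieldNormedType.Exports.
Local Open Scope classical_set_scope.
Local Open Scope ring_scope.

(* The function is the indicator of the set A of points of [1, 2)^n that avoid
   the digit b - 1 in base b = 2^M in every coordinate; A is Lebesgue null, and
   M is so large that the (b - 1)^n admissible subcubes of a cube outnumber
   b^delta.  Call a cube P light for a family of dyadic cubes if the members of
   the family meeting P have total weight at most a small multiple of l(P)^delta.
   By averaging, a light cube has a light admissible subcube of side l(P) / b, so
   it contains a chain of light cubes shrinking to a point that the family misses.
   Let phi be continuous and cover { |1_A - phi| > t }, t <= 1/4, by a family of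
   very small total weight.  Starting from [1, 2)^n we get an uncovered point x,
   which lies in A, so that phi(x) > 1/2, hence phi > 1/2 on some light cube P
   containing x.  The subcube of P all of whose digits are b - 1 is disjoint from
   A and still light, so it contains an uncovered point y; but y is not in A and
   phi(y) > 1/2, which is absurd. *)

(** * Dyadic cubes, their subcubes and nested chains *)

Section geometry.
Context {R : realType} {n : nat}.
Implicit Types P Q : dyadic n.

Lemma side_gt0 Q : 0 < side Q :> R.
Proof. by rewrite /side exprz_gt0. Qed.

Lemma natr_intr (m : nat) : m%:R = m%:Z%:~R :> R.
Proof. by []. Qed.

Lemma cube_dist Q (x y : 'rV[R]_n) i :
  cube Q x -> cube Q y -> `|x ord0 i - y ord0 i| < side Q.
Proof.
move=> /(_ i)/andP[x1 x2] /(_ i)/andP[y1 y2]; move: x2 y2.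
by rewrite intrD mulrDl mul1r => x2 y2; rewrite ltr_norml; apply/andP; split; lra.
Qed.

Lemma side_lt_level P Q : side Q < side P :> R -> Q.1 < P.1.
Proof. by rewrite /side ltr_eXz2l ?ltr1n. Qed.

(** In units of [side Q], each coordinate of [Q] is a unit interval with integer ends, and the cubes
    of level [P.1] tile the line by blocks of 2^d such intervals. Hence [Q] meets only one cube of
    that level. *)
Lemma cube_meet_unique P P' Q : P.1 = P'.1 -> Q.1 <= P.1 ->
  @cube R n Q `&` cube P !=set0 -> @cube R n Q `&` cube P' !=set0 -> P = P'.
Proof.
case: P P' => k m [k' m'] /= <-{k'} Qk [x [/= Qx Px]] [y [/= Qy Py]].
congr pair; apply/rowP => i.
have [d dE] : exists d : nat, k = Q.1 + d%:Z.
  by exists `|k - Q.1|%N; rewrite gez0_abs ?subr_ge0//; lra.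
have sE : side (k, m) = (2 ^ d)%N%:R * side Q :> R.
  by rewrite /side/= dE expfzDr// mulrC natrX.
have s0 := side_gt0 Q : 0 < side Q :> R.
have key (u : int) (z : R) : (Q.2 ord0 i)%:~R * side Q <= z <
    (Q.2 ord0 i + 1)%:~R * side Q ->
    u%:~R * side (k, m) <= z < (u + 1)%:~R * side (k, m) ->
    u * (2 ^ d)%N%:Z <= Q.2 ord0 i < (u + 1) * (2 ^ d)%N%:Z.
  rewrite sE !mulrA => /andP[z1 z2] /andP[u1 u2].
  have := le_lt_trans u1 z2; have := le_lt_trans z1 u2.
  rewrite !ltr_pM2r// natr_intr -!intrM !ltr_int.
  by rewrite ltzD1 => -> ->.
have /andP[m1 m2] := key _ _ (Qx i) (Px i).
have /andP[m1' m2'] := key _ _ (Qy i) (Py i).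
have d0 : 0 < (2 ^ d)%N%:Z by rewrite ltz_nat expn_gt0.
apply: le_anti; apply/andP; split; rewrite -ltzD1 -(ltr_pM2r d0).
  exact: le_lt_trans m1 m2'.
exact: le_lt_trans m1' m2.
Qed.

(* The subcubes of side 2^-M times that of P are indexed by digit vectors in
   base 2^M. *)
Definition child M P (d : 'I_n -> nat) : dyadic n :=
  (P.1 - M%:Z, \row_i (P.2 ord0 i * (2 ^ M)%N%:Z + (d i)%:Z)).

Lemma side_child M P d : side (child M P d) = side P / (2 ^ M)%N%:R :> R.
Proof. by rewrite /side/= expfzDr// natrX exprnN. Qed.

Lemma child_inj M P d d' : child M P d = child M P d' -> d =1 d'.
Proof. by case=> /rowP e i; have := e i; rewrite !mxE => /addrI[]. Qed.

Lemma child_cube M P d (x : 'rV[R]_n) : cube (child M P d) x <-> forall i,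
  (P.2 ord0 i * (2 ^ M)%N%:Z + (d i)%:Z)%:~R * side P <=
    x ord0 i * (2 ^ M)%N%:R <
  (P.2 ord0 i * (2 ^ M)%N%:Z + (d i).+1%:Z)%:~R * side P.
Proof.
have b0 : 0 < (2 ^ M)%N%:R :> R by rewrite ltr0n expn_gt0.
suff h i : ((child M P d).2 ord0 i)%:~R * side (child M P d) <= x ord0 i <
    ((child M P d).2 ord0 i + 1)%:~R * side (child M P d) = 
  ((P.2 ord0 i * (2 ^ M)%N%:Z + (d i)%:Z)%:~R * side P <=
    x ord0 i * (2 ^ M)%N%:R <
  (P.2 ord0 i * (2 ^ M)%N%:Z + (d i).+1%:Z)%:~R * side P).
  by split=> hx i; [rewrite -h; exact: hx|rewrite h; exact: hx].
rewrite side_child mxE !mulrA ler_pdivrMr// ltr_pdivlMr//.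
by rewrite -[(d i).+1]addn1 PoszD addrA.
Qed.

Lemma child_sub M P d : (forall i, (d i < 2 ^ M)%N) ->
  @cube R n (child M P d) `<=` cube P.
Proof.
move=> db x /child_cube xd i.
have b0 : 0 < (2 ^ M)%N%:R :> R by rewrite ltr0n expn_gt0.
have /andP[h1 h2] := xd i.
rewrite -(ler_pM2r b0) -[X in _ && X](ltr_pM2r b0); apply/andP; split.
  apply: le_trans h1; rewrite mulrAC ler_pM2r ?side_gt0//.
  by rewrite intrD intrM lerDl ler0n.
apply: lt_le_trans h2 _; rewrite mulrAC ler_pM2r ?side_gt0//.
by rewrite natr_intr -intrM ler_int mulrDl mul1r lerD2l lez_nat.
Qed.

Lemma cube_digit M P (x : 'rV[R]_n) : cube P x ->
  exists2 d : 'I_n -> nat, (forall i, (d i < 2 ^ M)%N) & cube (child M P d) x.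
Proof.
move=> xP; have b0 : 0 < (2 ^ M)%N%:R :> R by rewrite ltr0n expn_gt0.
pose z i := Num.floor (x ord0 i * (2 ^ M)%N%:R / side P) -
  P.2 ord0 i * (2 ^ M)%N%:Z.
have zlt i : 0 <= z i < (2 ^ M)%N%:Z.
  have /andP[x1 x2] := xP i; rewrite /z subr_ge0 ltrBlDl.
  rewrite floor_ge_int floor_lt_int ler_pdivlMr ?side_gt0//.
  rewrite ltr_pdivrMr ?side_gt0// -[X in _ + X]mul1r -mulrDl !intrM.
  by rewrite !(mulrAC _ _ (side P)) !ler_pM2r// x1 ltr_pM2r.
exists (fun i => `|z i|%N) => [i|].
  by have /andP[z0 zb] := zlt i; rewrite -ltz_nat gez0_abs.
apply/child_cube => i; have /andP[z0 zb] := zlt i.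
have zE : P.2 ord0 i * (2 ^ M)%N%:Z + z i =
    Num.floor (x ord0 i * (2 ^ M)%N%:R / side P) by rewrite addrC subrK.
rewrite -[(`|z i|%N).+1]addn1 PoszD gez0_abs// (addrA _ (z i)) zE.
have := floor_itv (x ord0 i * (2 ^ M)%N%:R / side P).
by rewrite ler_pdivlMr ?ltr_pdivrMr ?side_gt0.
Qed.

Lemma side_chain M (p : nat -> dyadic n) (d : nat -> 'I_n -> nat) :
  (forall k, p k.+1 = child M (p k) (d k)) ->
  forall k, side (p k) = side (p 0%N) / ((2 ^ M) ^ k)%N%:R :> R.
Proof.
move=> pS; elim=> [|k IH]; first by rewrite expn0 divr1.
by rewrite pS side_child IH -mulrA -invfM -natrM -expnSr.
Qed.

Lemma small_side M (p : nat -> dyadic n) (d : nat -> 'I_n -> nat) (e : R) :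
  (0 < M)%N -> (forall k, p k.+1 = child M (p k) (d k)) -> 0 < e ->
  exists k, side (p k) < e.
Proof.
move=> M0 pS e0; have := truncnS_gt (side (p 0%N) / e).
set k := (Num.truncn _).+1 => ltk; exists k.
have bk : (k < (2 ^ M) ^ k)%N.
  by rewrite ltn_expl// -[X in (X < _)%N](expn0 2) ltn_exp2l.
rewrite (side_chain pS) ltr_pdivrMr ?ltr0n ?expn_gt0//.
by rewrite mulrC -ltr_pdivrMr//; apply: lt_trans ltk _; rewrite ltr_nat.
Qed.

(* Since the last digit is forbidden, the closure of each cube of the chain lies
   below the upper faces of its predecessor, so that the nested half-open cubes
   do intersect. *)
Lemma chain_point M (p : nat -> dyadic n) (d : nat -> 'I_n -> nat) :
  (forall k, p k.+1 = child M (p k) (d k)) ->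
  (forall k i, (d k i < (2 ^ M).-1)%N) ->
  exists x : 'rV[R]_n, forall k, cube (p k) x.
Proof.
move=> pS db; have b0 : 0 < (2 ^ M)%N%:R :> R by rewrite ltr0n expn_gt0.
pose lo k i : R := ((p k).2 ord0 i)%:~R * side (p k).
pose up k i : R := ((p k).2 ord0 i + 1)%:~R * side (p k).
have loS k i : lo k i <= lo k.+1 i.
  rewrite /lo pS side_child mxE mulrA ler_pdivlMr// mulrAC.
  by rewrite ler_pM2r ?side_gt0// intrD intrM lerDl ler0n.
have upS k i : up k.+1 i < up k i.
  rewrite /up pS side_child mxE mulrA ltr_pdivrMr// mulrAC.
  rewrite ltr_pM2r ?side_gt0// natr_intr -intrM ltr_int.
  rewrite mulrDl mul1r -addrA ltrD2l -PoszD addn1 ltz_nat.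
  have := expn_gt0 2 M; have := db k i; lia.
have lo_homo i : {homo lo ^~ i : k l / (k <= l)%N >-> k <= l}.
  by apply/nondecreasing_seqP.
have up_homo i : {homo up ^~ i : k l / (k <= l)%N >-> l <= k}.
  by apply/nonincreasing_seqP => k; exact: ltW.
have lo_up k l i : lo k i <= up l i.
  apply: le_trans (lo_homo i _ _ (leq_maxl k l)) _.
  apply: le_trans (up_homo i _ _ (leq_maxr k l)).
  by rewrite /lo /up ler_pM2r ?side_gt0// ler_int lerDl.
exists (\row_i sup (range (lo ^~ i))) => k i; rewrite mxE; apply/andP; split.
  apply: ub_le_sup; last by exists k.
  by exists (up 0%N i) => _ [l _ <-].
apply: le_lt_trans (upS k i); apply: ge_sup; first by exists (lo k i), k.
by move=> _ [l _ <-].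
Qed.

End geometry.

(** * Light cubes and the averaging argument *)

Section light_cubes.
Context {R : realType} {n : nat} (delta : R) (D : set nat) (Q : nat -> dyadic n).
Implicit Types P : dyadic n.

Definition weight (i : nat) : \bar R := (side (Q i) `^ delta)%:E.

Definition meets P : set nat :=
  [set i | @cube R n (Q i) `&` cube P !=set0].

Definition load P : \bar R := \esum_(i in D `&` meets P) weight i.

Definition light (c : R) P := (load P < (c * side P `^ delta)%:E)%E.

Lemma weight_ge0 i : (0 <= weight i)%E.
Proof. by rewrite lee_fin powR_ge0. Qed.

Lemma weight_le_load P i : D i -> meets P i -> (weight i <= load P)%E.
Proof.
move=> Di iP; apply: esum_ge; exists [set i]; last by rewrite fsbig_set1.
by split=> // _ ->.
Qed.

Lemma load_le P P' : @cube R n P' `<=` cube P -> (load P' <= load P)%E.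
Proof.
move=> PP'; rewrite /load 2!esum_mkcondr; apply: le_esum => i _.
have [|_] := boolP (i \in meets P'); last first.
  by case: ifP => // _; exact: weight_ge0.
rewrite inE => -[x [xQ xP]]; rewrite ifT// inE; exists x; split => //.
exact: PP'.
Qed.

Section base.
Variables (M : nat) (c : R).
Let b : R := (2 ^ M)%N%:R.
Hypotheses (delta0 : 0 < delta) (cb : c <= (b `^ delta)^-1).

Let b_gt0 : 0 < b. Proof. by rewrite ltr0n expn_gt0. Qed.

Lemma powR_side_child P d :
  side (child M P d) `^ delta = side P `^ delta / b `^ delta.
Proof.
apply: (mulIf (lt0r_neq0 (powR_gt0 delta b_gt0))).
rewrite mulfVK ?lt0r_neq0 ?powR_gt0// -powRM ?ltW ?side_gt0//.
by rewrite side_child mulfVK// lt0r_neq0.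
Qed.

(** A single weight is at most the load, hence below c l(P)^delta <= (l(P) / b)^delta; the power is
    monotone. *)
Lemma light_side P i : light c P -> D i -> meets P i -> side (Q i) < side P / b.
Proof.
move=> lP Di iP; have := le_lt_trans (weight_le_load Di iP) lP.
rewrite lte_fin => /lt_le_trans h.
(* The child with zero digits serves only as a cube of side l(P) / b. *)
have : side (Q i) `^ delta < side (child M P (fun=> 0%N)) `^ delta.
  by rewrite powR_side_child h// mulrC ler_wpM2l ?powR_ge0.
rewrite -(side_child _ _ (fun=> 0%N)).
rewrite !ltNge; apply: contra => le; apply: ge0_ler_powR => //; first exact: ltW.
all: by rewrite nnegrE ltW// side_gt0.
Qed.

(* A cube of the family meeting a light cube P is smaller than the children
   of P, hence meets at most one of them; so the loads of the children add up to
   at most the load of P, and averaging applies. *)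
Lemma light_child P : b `^ delta <= ((2 ^ M).-1 ^ n)%N%:R -> light c P ->
  exists d : {ffun 'I_n -> 'I_(2 ^ M).-1}, light c (child M P (fun i => d i)).
Proof.
move=> bn lP; apply: contrapT => /forallNP heavy.
have db (d : {ffun 'I_n -> 'I_(2 ^ M).-1}) i : (d i < 2 ^ M)%N.
  by apply: leq_trans (ltn_ord _) (leq_pred _).
have : (\sum_(d : {ffun 'I_n -> 'I_(2 ^ M).-1})
    (c * (side P `^ delta / b `^ delta))%:E <= load P)%E.
  apply: (@le_trans _ _ (\sum_(d : {ffun 'I_n -> 'I_(2 ^ M).-1})
      load (child M P (fun i => d i)))%E).
    by apply: lee_sum => d _; rewrite leNgt -(powR_side_child P (fun i => d i));
      exact/negP/heavy.
  rewrite /load esum_mkcondr.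
  under eq_bigr do rewrite esum_mkcondr.
  rewrite -esum_sum; last by move=> i d _ _; case: ifP => // _; exact: weight_ge0.
  apply: le_esum => i Di.
  have [[d0 id0]|none] := pselect (exists d : {ffun 'I_n -> 'I_(2 ^ M).-1},
      meets (child M P (fun i => d i)) i); last first.
    rewrite big1 => [|d _]; first by case: ifP => // _; exact: weight_ge0.
    by rewrite ifF//; apply/negP; rewrite inE => id; apply: none; exists d.
  have iP : meets P i.
    by have [x [xQ xd]] := id0; exists x; split => //; exact: child_sub xd.
  have Qsmall : (Q i).1 <= (child M P (fun i => d0 i)).1.
    by apply/ltW/(@side_lt_level R); rewrite side_child; exact: light_side.
  rewrite (bigD1 d0)//= big1 => [|d dd0]; first by rewrite adde0 !ifT ?inE.
  rewrite ifF//; apply/negP; rewrite inE => id; move/negP: dd0; apply.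
  have dE : child M P (fun i => d0 i) = child M P (fun i => d i).
    exact: (cube_meet_unique _ Qsmall id0 id).
  by apply/eqP/ffunP => j; apply/val_inj/esym; exact: (child_inj dE).
(* The sum has (b - 1)^n >= b^delta equal terms, so it is at least c l(P)^delta, against the
   lightness of [P]. *)
rewrite sumEFin sumr_const card_ffun !card_ord leNgt => /negP; apply.
apply: (lt_le_trans lP); rewrite lee_fin.
have c0 : 0 <= c.
  rewrite -(pmulr_lge0 _ (powR_gt0 delta (side_gt0 P))) -lee_fin ltW//.
  by apply: (le_lt_trans _ lP); apply: esum_ge0 => i _; exact: weight_ge0.
rewrite -mulr_natr -!mulrA ler_wpM2l// ler_peMr ?powR_ge0//.
by rewrite mulrC ler_pdivlMr ?powR_gt0// mul1r.
Qed.

(** Iterating [light_child] gives the chain. A member of the family containing the limit point would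
    meet every [p k], so by [light_side] it would be smaller than all of them, while their sides
    tend to 0. *)
Lemma light_chain P : (0 < M)%N -> b `^ delta <= ((2 ^ M).-1 ^ n)%N%:R ->
  light c P ->
  exists (p : nat -> dyadic n) (d : nat -> {ffun 'I_n -> 'I_(2 ^ M).-1})
    (x : 'rV[R]_n),
    [/\ p 0%N = P, forall k, p k.+1 = child M (p k) (fun i => d k i),
        forall k, light c (p k), forall k, cube (p k) x &
        forall i, D i -> ~ cube (Q i) x].
Proof.
move=> M0 bn lP.
have /choice[g gP] P' : exists d : {ffun 'I_n -> 'I_(2 ^ M).-1},
    light c P' -> light c (child M P' (fun i => d i)).
  have [/(light_child bn)[d]|?] := pselect (light c P'); first by exists d.
  (* For a cube that is not light any digit vector will do; the light cube [P] supplies one. *)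
  have [d _] := light_child bn lP.
  by exists d.
pose p k := iter k (fun P' => child M P' (fun i => g P' i)) P.
have pl k : light c (p k) by elim: k => // k IH; exact: gP.
have pS k : p k.+1 = child M (p k) (fun i => g (p k) i) by [].
have [x px] := @chain_point R n M p (fun k i => g (p k) i) pS
  (fun k i => ltn_ord (g (p k) i)).
exists p, (fun k => g (p k)), x; split => // i Di ix.
have [k] := small_side M0 pS (side_gt0 (Q i) : 0 < side (Q i) :> R).
apply/negP; rewrite -leNgt ltW//.
have ipk : meets (p k) i by exists x.
apply: lt_le_trans (light_side (pl k) Di ipk) _.
rewrite ler_pdivrMr// ler_peMr ?ltW ?side_gt0//.
by rewrite /b ltr1n -{1}(expn0 2) ltn_exp2l.
Qed.

End base.
End light_cubes.

(** * The Cantor-type set and its Lebesgue measure *)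

Section cantor_set.
Context {R : realType} {n : nat} (M : nat).
Local Notation b := (2 ^ M)%N.

Definition root_cube : dyadic n := (0, const_mx 1).

(* The points of [1, 2)^n none of whose coordinates has a digit 2^M - 1 in base
   2^M.  The cube [1, 2)^n, unlike [0, 1)^n, lies in the interior of a single
   dyadic cube, namely [0, 4)^n. *)
Definition cantor_set : set 'rV[R]_n := [set x | cube root_cube x /\
  forall k P (d : 'I_n -> nat), P.1 = - (k * M)%N%:Z -> (forall i, (d i < b)%N) ->
    cube (child M P d) x -> forall i, (d i < b.-1)%N].

Lemma cube_unique (P P' : dyadic n) (x : 'rV[R]_n) :
  P.1 = P'.1 -> cube P x -> cube P' x -> P = P'.
Proof.
by move=> PP' Px P'x; apply: (@cube_meet_unique R n P P' P) => //; exists x.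
Qed.

Lemma level_chain (p : nat -> dyadic n) (d : nat -> 'I_n -> nat) :
  p 0%N = root_cube -> (forall k, p k.+1 = child M (p k) (d k)) ->
  forall k, (p k).1 = - (k * M)%N%:Z.
Proof.
move=> p0 pS; elim=> [|k IH]; first by rewrite p0.
by rewrite pS /= IH mulSn PoszD opprD addrC.
Qed.

(** Cubes of one level are disjoint, so the digits of [x] can only be those recorded by the
    chain. *)
Lemma chain_cantor_set (p : nat -> dyadic n) (d : nat -> 'I_n -> nat)
    (x : 'rV[R]_n) :
  p 0%N = root_cube -> (forall k, p k.+1 = child M (p k) (d k)) ->
  (forall k i, (d k i < b.-1)%N) -> (forall k, cube (p k) x) -> cantor_set x.
Proof.
move=> p0 pS db px; split=> [|k P d' Pk d'b xd' i]; first by rewrite -p0.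
have Pp : P = p k.
  by apply: (cube_unique _ (child_sub d'b xd')) => //; rewrite Pk (level_chain p0 pS).
rewrite (@child_inj n M P d' (d k)) ?db//.
by apply: (cube_unique _ xd'); [|rewrite Pp -pS].
Qed.

Lemma cantor_set_child k P (x : 'rV[R]_n) :
  (0 < n)%N -> P.1 = - (k * M)%N%:Z ->
  cube (child M P (fun=> b.-1)) x -> ~ cantor_set x.
Proof.
move=> n0 Pk xP [_ /(_ _ _ _ Pk _ xP (Ordinal n0))]; rewrite ltnn => h.
by have: false by apply: h => _; rewrite prednK// expn_gt0.
Qed.

Lemma outer_cube P : (lebesgue_outer (@cube R n P) <= (side P ^+ n)%:E)%E.
Proof.
apply: ereal_inf_lbound; exists [set 0%N], (fun=>
  (\row_i ((P.2 ord0 i)%:~R * side P), \row_i ((P.2 ord0 i + 1)%:~R * side P))).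
split=> [x xP|]; first by exists 0%N => // i; rewrite !mxE; exact: xP.
rewrite esum_set1 ?lee_fin ?box_volume_ge0//; congr EFin.
rewrite /box_volume; under eq_bigr => i _.
  rewrite !mxE intrD mulrDl mul1r addrAC subrr add0r.
  rewrite max_r ?ltW ?side_gt0//.
  over.
by rewrite prodr_const card_ord.
Qed.

Lemma outer_bigsetU (I : finType) (F : I -> set 'rV[R]_n) :
  (lebesgue_outer (\big[setU/set0]_i F i) <= \sum_i lebesgue_outer (F i))%E.
Proof.
elim/big_ind2 : _ => [|A s B t As Bt|//]; first by rewrite outer_measure0.
by apply: le_trans (outer_measureU2 _ _ _) _; exact: leeD.
Qed.

(** Only (b - 1)^n of the b^n children of a cube meet the set, so each generation gains the factor
    ((b - 1) / b)^n. *)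
Lemma outer_cantor_cube j k P : P.1 = - (k * M)%N%:Z ->
  (lebesgue_outer (cube P `&` cantor_set) <=
    (side P ^+ n * ((b.-1%:R / b%:R) ^+ n) ^+ j)%:E)%E.
Proof.
elim: j k P => [|j IH] k P Pk.
  rewrite expr0 mulr1; apply: le_trans (outer_cube P).
  apply: le_lebesgue_outer; exact: subIsetl.
have sub : cube P `&` cantor_set `<=`
    \big[setU/set0]_(d : {ffun 'I_n -> 'I_b.-1})
      (cube (child M P (fun i => d i)) `&` cantor_set).
  move=> x [xP xA]; have [d db xd] := cube_digit M xP.
  have db' := xA.2 _ _ _ Pk db xd.
  pose d' := [ffun i => Ordinal (db' i)].
  rewrite (bigD1 d')//=; left; split=> //.
  by rewrite (_ : (fun i => _) = d)//; apply/funext => i; rewrite ffunE.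
apply: le_trans (le_lebesgue_outer sub) _.
apply: le_trans (outer_bigsetU _) _.
have Sk d : (child M P d).1 = - (k.+1 * M)%N%:Z.
  by rewrite /= Pk mulSn PoszD opprD addrC.
apply: le_trans (lee_sum _ (fun d _ => IH _ _ (Sk _))) _.
under eq_bigr do rewrite side_child.
rewrite sumEFin sumr_const card_ffun !card_ord lee_fin exprS.
set v := (_ ^+ j); rewrite !expr_div_n -[leLHS]mulr_natr (natrX R b.-1 n).
by rewrite le_eqVlt; apply/orP; left; apply/eqP; ring.
Qed.

Lemma outer_cantor_set : (0 < n)%N -> lebesgue_outer cantor_set = 0%E.
Proof.
move=> n0; apply/eqP; rewrite eq_le lebesgue_outer_ge0 andbT.
apply/lee_addgt0Pr => e e0; rewrite add0e.
set r : R := (b.-1%:R / b%:R) ^+ n.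
have b0 : (0 < b)%N by rewrite expn_gt0.
have r0 : 0 <= r by rewrite exprn_ge0// divr_ge0.
have r1 : `|r| < 1.
  rewrite ger0_norm// exprn_ilt1 ?divr_ge0 -?lt0n//.
  by rewrite ltr_pdivrMr ?ltr0n// mul1r ltr_nat prednK.
have /cvgrPdist_lt /(_ _ e0)[j _ /(_ j (leqnn j))] := cvg_expr r1.
rewrite sub0r normrN ger0_norm ?exprn_ge0// => rj.
have -> : cantor_set = cube root_cube `&` cantor_set.
  by apply/seteqP; split=> [x xA|x []//]; split => //; exact: xA.1.
apply: le_trans (@outer_cantor_cube j 0%N root_cube _) _ => //.
by rewrite /side/= expr1n mul1r lee_fin ltW.
Qed.

Lemma measurable_cantor_set : (0 < n)%N ->
  lebesgue_measurable_fun (fun x => (\1_cantor_set x)%:E : \bar R).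
Proof.
move=> n0; apply/measurable_EFinP; apply: measurable_indic.
(* A set of outer measure zero satisfies the Caratheodory condition. *)
apply: le_caratheodory_measurable => X /=.
rewrite -[leRHS]add0e; apply: leeD.
  rewrite -(outer_cantor_set n0); apply: le_lebesgue_outer; exact: subIsetr.
apply: le_lebesgue_outer; exact: subIsetl.
Qed.

End cantor_set.

(** * Integral comparison and elementary bounds on the content *)

(** The integral of a nonnegative function is a supremum over simple functions below it, which is
    monotone without measurability. Choquet integrals can thus be compared without studying the
    content as a function of the level t. *)
Lemma ge0_le_integral_nonmeasurable d (T : measurableType d) (R : realType)
    (mu : {measure set T -> \bar R}) (D : set T) (f g : T -> \bar R) :
  (forall x, D x -> 0 <= f x)%E -> (forall x, D x -> f x <= g x)%E ->
  (\int[mu]_(x in D) f x <= \int[mu]_(x in D) g x)%E.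
Proof.
move=> f0 fg; rewrite [leLHS]integral_mkcond [leRHS]integral_mkcond.
have fgD x : (0 <= (f \_ D) x <= (g \_ D) x)%E.
  by rewrite /patch; case: ifPn; rewrite ?lexx// inE => Dx; rewrite f0//= fg.
rewrite !ge0_integralTE => [||x].
- apply: ereal_sup_le => _ [h hf <-]; exists h => //= x.
  by apply: le_trans (hf x) _; have /andP[] := fgD x.
- by move=> x; have /andP[] := fgD x; exact: le_trans.
- by have /andP[] := fgD x.
Qed.

Lemma integral_const_itv (R : realType) (a c : R) : 0 <= a ->
  (\int[@lebesgue_measure R]_(t in `]0%R, +oo[)
    ((cst c%:E) \_ `]0%R, a]) t = (c * a)%:E)%E.
Proof.
move=> a0; rewrite -integral_mkcondr.
rewrite (_ : _ `&` _ = `]0%R, a]%classic).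
  rewrite integral_cst//= lebesgue_measure_itv/= lte_fin.
  have [->|an0] := eqVneq a 0; last by rewrite lt0r an0 a0 sube0.
  by rewrite ltxx mulr0 mule0.
apply/seteqP; split=> x /=; rewrite !in_itv/= andbT; first by case.
by move=> /andP[-> ->].
Qed.

Section content.
Context {R : realType} {n : nat} (delta : R).
Implicit Types E : set 'rV[R]_n.

Lemma dyadic_content_ge0 E : (0 <= dyadic_content delta E)%E.
Proof.
apply: le_ereal_inf_tmp => _ [D [Q [_ ->]]].
by apply: esum_ge0 => i _; exact: weight_ge0.
Qed.

Lemma dyadic_content0 : dyadic_content delta (@set0 'rV[R]_n) = 0%E.
Proof.
apply/eqP; rewrite eq_le dyadic_content_ge0 andbT; apply: ereal_inf_lbound.
by exists set0, (fun=> (0, 0)); split; [exact: sub0set|rewrite esum_set0].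
Qed.

Lemma dyadic_content_cantor_set M :
  (dyadic_content delta (@cantor_set R n M) <= (4 `^ delta)%:E)%E.
Proof.
apply: ereal_inf_lbound; exists [set 0%N], (fun=> (2, 0)); split; last first.
  by rewrite esum_set1 ?weight_ge0// /weight /side -exprnP -natrX.
move=> x [xr _]; rewrite bigcup_set1; apply/nbhs_ballP; exists 1 => //= y [_ xy] i.
have := xr i; have := xy ord0 i; rewrite /side/= !mxE /ball/= ltr_norml.
rewrite expr0z !mulr1 mul0r add0r mul1r -exprnP => /andP[? ?] /andP[? ?].
by apply/andP; split; lra.
Qed.

End content.

(** * Lower bound for the approximation error *)

Section approximation.
Context {R : realType} {n : nat} (delta : R) (M : nat).
Hypotheses (n0 : (0 < n)%N) (delta0 : 0 < delta) (M0 : (0 < M)%N).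
Local Notation b := (2 ^ M)%N.
Hypothesis digits_enough : (b%:R : R) `^ delta <= (b.-1 ^ n)%N%:R.
Local Notation A := (@cantor_set R n M).
(** One factor b^-delta is the threshold required by [light_chain]; the other pays for the later
    passage to the child with all digits b - 1. *)
Let c0 : R := (b%:R `^ delta)^-1 / b%:R `^ delta.

Lemma content_error_ge (phi : 'rV[R]_n -> R) (E : set 'rV[R]_n) :
  continuous phi ->
  (forall x, A x -> phi x <= 1/2 -> E x) ->
  (forall x, ~ A x -> 1/2 < phi x -> E x) ->
  (c0%:E <= dyadic_content delta E)%E.
Proof.
move=> cphi EA EnA; apply: le_ereal_inf_tmp => _ [D [Q [EQ ->]]].
rewrite leNgt; apply/negP => small.
have Q_E x : (forall j, D j -> ~ cube (Q j) x) -> ~ E x.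
  by move=> Qx /EQ/interior_subset[j Dj]; exact: Qx.
have b0 : 0 < b%:R :> R by rewrite ltr0n expn_gt0.
have bd1 : 1 <= b%:R `^ delta :> R.
  by rewrite -[leLHS](powRr0 b%:R) ler_powR ?ler1n ?expn_gt0// ltW.
have c0b : c0 <= (b%:R `^ delta)^-1.
  by rewrite /c0 ler_pdivrMr ?powR_gt0// ler_peMr// invr_ge0 powR_ge0.
have root_light : light delta D Q c0 root_cube.
  rewrite /light /side/= expr0z powR1 mulr1; apply: le_lt_trans small.
  rewrite /load esum_mkcondr; apply: le_esum => i _.
  by case: ifP => // _; exact: weight_ge0.
have [p [d [x [p0 pS pl px xQ]]]] :=
  light_chain delta0 c0b M0 digits_enough root_light.
have xA : A x by apply: (chain_cantor_set p0 pS) => // k i; exact: ltn_ord.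
have phix : 1/2 < phi x.
  by rewrite ltNge; apply/negP => /(EA _ xA); exact: Q_E.
have [e /= e0 xe] : exists2 e, 0 < e & ball x e `<=` [set y | 1/2 < phi y].
  have /nbhs_ballP[e e0 xe] : nbhs x (phi @^-1` [set t | 1/2 < t]).
    by apply: cphi; exact: (open_nbhs_nbhs (conj (@open_gt R (1/2)) phix)).
  by exists e.
have [k ke] := small_side M0 pS e0.
have lchild : light delta D Q (b%:R `^ delta)^-1 (child M (p k) (fun=> b.-1)).
  rewrite /light powR_side_child.
  have -> : (b%:R `^ delta)^-1 * (side (p k) `^ delta / b%:R `^ delta) =
    c0 * side (p k) `^ delta :> R by rewrite mulrCA mulrC.
  (* The load does not grow on passing to a subcube, so only the constant changes, from [c0] to
     b^-delta, still enough for a second descent. *)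
  apply: le_lt_trans (pl k); apply: load_le; apply: child_sub => i.
  by rewrite prednK// expn_gt0.
have [q [d' [y [q0 qS ql qy yQ]]]] :=
  light_chain delta0 (lexx _) M0 digits_enough lchild.
have yc := qy 0%N; rewrite q0 in yc.
have ypk : cube (p k) y.
  by apply: child_sub yc => i; rewrite prednK// expn_gt0.
apply: (Q_E y yQ); apply: EnA.
  exact: (cantor_set_child n0 (level_chain p0 pS k) yc).
apply: xe; split=> // i j; rewrite ord1.
exact: lt_trans (cube_dist j (px k) ypk) ke.
Qed.

Lemma NL1_norm_error_ge (phi : 'rV[R]_n -> R) : continuous phi ->
  ((c0 * (1/4))%:E <=
    NL1_norm delta setT (fun x => (\1_A x)%:E - (phi x)%:E))%E.
Proof.
move=> cphi; rewrite -integral_const_itv//.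
have c0_ge0 : 0 <= c0 by rewrite mulr_ge0 ?invr_ge0 ?powR_ge0.
rewrite /NL1_norm /choquet.
apply: ge0_le_integral_nonmeasurable => t _; rewrite /patch.
  by case: ifPn; rewrite ?lee_fin.
case: ifPn => [|_]; last exact: dyadic_content_ge0.
rewrite inE/= in_itv/= => /andP[_ t4].
(* In both cases the error is at least 1/2, which exceeds t <= 1/4. *)
apply: (content_error_ge cphi) => x Ax hx; split=> //=.
  rewrite lte_fin indicE mem_set//= ger0_norm; lra.
rewrite lte_fin indicE memNset//= distrC ger0_norm; lra.
Qed.

End approximation.

(** * Integrability, choice of the base and conclusion *)

(** The superlevel sets lie in the Cantor set for 0 < t <= 1 and are empty for t > 1, so the
    integral is at most 4^delta. *)
Lemma NL1_cantor_set (R : realType) (n M : nat) (delta : R) :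
  NL1 delta setT (fun x : 'rV[R]_n => (\1_(cantor_set M) x)%:E).
Proof.
rewrite /NL1/= /NL1_norm /choquet.
apply: (@le_lt_trans _ _ ((4 `^ delta) * 1)%:E); last by rewrite ltry.
rewrite -integral_const_itv//; apply: ge0_le_integral_nonmeasurable => t /=.
  by move=> _; exact: dyadic_content_ge0.
rewrite in_itv/= andbT => t0; rewrite /patch; case: ifPn => [_|].
  rewrite /cst; apply: le_trans (dyadic_content_cantor_set delta M).
  apply: ereal_inf_le_tmp => _ [D [Q [AQ ->]]]; exists D, Q; split=> //.
  move=> x [_]; rewrite lte_fin indicE; case: (boolP (x \in _)); rewrite ?inE.
    by move=> xA _; exact: AQ.
  by rewrite normr0 ltNge ltW.
rewrite notin_setE/= in_itv/= t0/= => /negP; rewrite -ltNge => t1.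
rewrite (_ : [set x | _] = set0) ?dyadic_content0//.
apply/seteqP; split=> x //= [_]; rewrite lte_fin indicE.
by case: (x \in _); rewrite ?normr1 ?normr0; lra.
Qed.

(** As 2^M - 1 >= 2^(M - 1), it suffices that M delta <= (M - 1) n, that is, M >= n / (n -
    delta). *)
Lemma base_exists (R : realType) (n : nat) (delta : R) : delta < n%:R ->
  exists2 M : nat, (0 < M)%N &
    ((2 ^ M)%N%:R : R) `^ delta <= ((2 ^ M).-1 ^ n)%N%:R.
Proof.
move=> dn; have dn0 : 0 < n%:R - delta by rewrite subr_gt0.
have := truncnS_gt (n%:R / (n%:R - delta)).
set M := (Num.truncn _).+1; rewrite ltr_pdivrMr// => hM; exists M => //.
apply: (@le_trans _ _ ((2 ^ M.-1)%N%:R ^+ n)); last first.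
  rewrite (natrX R (2 ^ M).-1) lerXn2r ?nnegrE ?ler0n// ler_nat.
  have := expn_gt0 2 M.-1; rewrite -[M in (2 ^ M).-1%N]/(M.-1.+1) expnS; lia.
rewrite !natrX -exprM -!powR_mulrn// -powRrM ler_powR ?ler1n//.
have MR : M%:R = M.-1%:R + 1 :> R by rewrite natr1.
rewrite natrM; rewrite MR in hM *; nra.
Qed.

Theorem mainTheorem4 (R : realType) (n : nat) (delta : R)
    (hn : (1 <= n)%N) (hdelta0 : 0 < delta) (hdeltan : delta < n%:R) :
  (exists f : 'rV[R]_n -> \bar R,
     [/\ lebesgue_measurable_fun f,
         NL1 delta setT f &
         ~ NL1_limit_continuous delta f]) /\
  ~ @continuous_dense_NL1 R n delta.
Proof.
have [M M0 hM] := base_exists hdeltan.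
pose f (x : 'rV[R]_n) : \bar R := (\1_(@cantor_set R n M) x)%:E.
have b0 : 0 < (2 ^ M)%N%:R `^ delta :> R by rewrite powR_gt0// ltr0n expn_gt0.
pose e : R := ((2 ^ M)%N%:R `^ delta)^-1 / (2 ^ M)%N%:R `^ delta * (1/4).
have e0 : 0 < e by rewrite !mulr_gt0 ?invr_gt0.
have far phi : continuous phi ->
    (e%:E <= NL1_norm delta setT (fun x => f x - (phi x)%:E))%E.
  exact: NL1_norm_error_ge.
have fNL1 : NL1 delta setT f by exact: NL1_cantor_set.
split; last first.
  move=> /(_ f fNL1 e e0)[phi [cphi _]]; apply/negP; rewrite -leNgt; exact: far.
exists f; split=> //; first exact: measurable_cantor_set.
move=> [phi [cphi lim]].
have : (e%:E <= 0)%E.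
  apply: (closed_cvg _ (@closed_ereal_le_ereal _ e%:E) _ _ lim).
  by apply: nearW => i; exact: far.
by rewrite lee_fin leNgt e0.
Qed.
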